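(* Let $d\ge1$, $\delta_0\in(0,1]$, $\gamma\in(0,1)$ and $r_1,r_2\in[1,d/(d-\delta_0(1-\gamma)))$. Suppose that $\pi$ is a correlation satisfying Condition$(\delta_0,\gamma,r_2)$ (defined in the context). If $r_1<r_2$, then $\pi$ also satisfies Condition$(\delta_0,\gamma,r_1)$.
   Context: A tempered distribution $\pi$ on $\mathbb R^d$ is nonnegative definite if $(\pi,\psi*\overline{\tilde\psi})\ge0$ for every Schwartz function $\psi$, where $\tilde\psi(x)=\psi(-x)$. A nonnegative tempered distribution is identified with a tempered measure, i.e. a nonnegative Borel measure with $\int_{\mathbb R^d}(1+|x|^2)^{-k/2}\pi(\mathrm dx)<\infty$ for some $k\ge0$. For $r\in[1,d/(d-\delta_0(1-\gamma)))$ set $\alpha_{\delta_0,\gamma,r}:=d-r(d-\delta_0(1-\gamma))\in(0,d)$. Condition$(\delta_0,\gamma,r)$ on $\pi$ (called the reinforced Dalang condition if $r=1$, the strongly reinforced Dalang condition if $r>1$) means: (i) $\pi$ is a nonnegative and nonnegative definite tempered distribution; (ii) $\int_{|x|<1}|x|^{2\alpha_{\delta_0,\gamma,r}-d}\pi(\mathrm dx)<\infty$ if $0<\alpha_{\delta_0,\gamma,r}<d/2$; $\int_{|x|<1}\log(1/|x|)\pi(\mathrm dx)<\infty$ if $\alpha_{\delta_0,\gamma,r}=d/2$; no further condition if $\alpha_{\delta_0,\gamma,r}>d/2$. At $x=0$ the integrands are read as $+\infty$. *)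

(* Defs.v *)
From HB Require Import structures.
From mathcomp Require Import all_boot all_order all_algebra.
From mathcomp Require Import all_classical all_reals all_analysis.
From mathcomp Require Import complex.

Set Implicit Arguments.
Unset Strict Implicit.
Unset Printing Implicit Defensive.

Import Order.TTheory GRing.Theory Num.Theory.
Import numFieldNormedType.Exports.

Local Open Scope classical_set_scope.
Local Open Scope ring_scope.
Local Open Scope complex_scope.

(* R^d with its Borel sigma-algebra, as an alias of 'rV[R]_d. *)
Notation borelRd R d := (g_sigma_algebraType (@open 'rV[R]_d)).

(* The library norm `|x| on 'rV[R]_d is the sup norm. *)
Definition euclid (R : realType) (d : nat) (x : 'rV[R]_d) : R :=
  Num.sqrt (\sum_(i < d) x ord0 i ^+ 2).

Section lebesgue_rV.
Variable R : realType.

Definition snocRd (n : nat) (p : borelRd R n * measurableTypeR R) :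
  borelRd R n.+1 := \row_(i < n.+1) oapp (fun j => p.1 ord0 j) p.2 (unlift ord_max i).

Lemma open_rV_bigcup (n : nat) (U : set 'rV[R]_n) : open U ->
  U = \bigcup_(k in [set k : 'rV[rat]_n * nat |
        ball (map_mx ratr k.1 : 'rV[R]_n) k.2.+1%:R^-1 `<=` U])
      ball (map_mx ratr k.1 : 'rV[R]_n) k.2.+1%:R^-1.
Proof.
move=> oU; apply/seteqP; split => [x Ux|x [k kU]]; last exact: kU.
have /nbhs_ballP[e /= e0 xeU] : nbhs x U by exact: open_nbhs_nbhs.
have [k ke] : exists k : nat, k.+1%:R^-1 < e / 2 :> R.
  have [k _ hk] := near_infty_natSinv_lt (PosNum (divr_gt0 e0 (ltr0n R 2))).
  by exists k; apply: hk => /=.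
have k0 : 0 < k.+1%:R^-1 :> R by rewrite invr_gt0 ltr0n.
have /choice[q hq] : forall i : 'I_n, exists q : rat,
    `|x ord0 i - ratr q| < k.+1%:R^-1 :> R.
  move=> i; have /rat_in_itvoo[q qi] :
    x ord0 i - k.+1%:R^-1 < x ord0 i + k.+1%:R^-1 :> R.
    by rewrite ltrD2l gtrN.
  exists q; rewrite distrC ltr_distl.
  by move: qi; rewrite in_itv /= => /andP[-> ->].
have qx : ball (map_mx ratr (\row_i q i) : 'rV[R]_n) k.+1%:R^-1 x.
  by split=> // i j; rewrite ord1 !mxE; rewrite /ball /= distrC; exact: hq.
exists (\row_i q i, k) => //= y qy.
apply: xeU; rewrite (splitr e); apply: ball_triangle.
  by apply: ball_sym; apply: le_ball qx; exact: ltW.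
by apply: le_ball qy; exact: ltW.
Qed.

Lemma measurable_snocRd (n : nat) : measurable_fun setT (@snocRd n).
Proof.
have gen := @measurability _ _ _ _ setT (@snocRd n) (@open 'rV[R]_n.+1).
apply: gen => // _ [U oU <-].
rewrite setTI (open_rV_bigcup oU) preimage_bigcup bigcup_mkcond.
apply: countable_bigcupT_measurable => // -[q k].
case: ifPn => _ //.
set c : 'rV[R]_n.+1 := map_mx ratr q; set e : R := k.+1%:R^-1.
have e0 : 0 < e by rewrite invr_gt0 ltr0n.
move: c e e0 => c e e0.
rewrite (_ : _ @^-1` _ =
  ball (\row_(j < n) c ord0 (lift ord_max j)) e `*` ball (c ord0 ord_max) e).
  apply: measurableX.
    by apply: sub_sigma_algebra; exact: ball_open.
  by rewrite ball_itv; exact: measurable_itv.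
apply/seteqP; split=> [[v t] /= [_ h]|[v t] /= [[_ hv] ht]].
- split; first (split=> // i j).
    by have := h ord0 (lift ord_max j); rewrite (ord1 i) !mxE liftK.
  by have := h ord0 ord_max; rewrite !mxE unlift_none.
- split=> // i j; rewrite (ord1 i) mxE; case: unliftP => [j' ->|->] //=.
  by have := hv ord0 j'; rewrite mxE.
Qed.

(* The HB-generated measure structure on pushforward mu f, for f measurable. *)
Local Notation pushforward_measure :=
  measure_function_pushforward__canonical__measure_function_Measure.

Fixpoint lebesgue_Rd (n : nat) : {measure set (borelRd R n) -> \bar R} :=
  match n with
  | 0 => dirac ((0 : 'rV[R]_0) : borelRd R 0)
  | m.+1 => pushforward_measure
      (lebesgue_Rd m \x (@lebesgue_measure R))%E (@measurable_snocRd m)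
  end.

End lebesgue_rV.

Section correlations.
Variables (R : realType) (d : nat).
Local Notation Rd := 'rV[R]_d.
Local Notation C := R[i].
Implicit Types (f g psi : Rd -> C) (s : seq 'I_d).

(* The iterated partial derivative along the coordinates listed in s. *)
Definition partial s (u : Rd -> R) : Rd -> R :=
  foldr (fun i v x => 'D_(delta_mx ord0 i) v x) u s.

Definition smooth (u : Rd -> R) : Prop := forall s,
  continuous (partial s u) /\
  forall i x, derivable (partial s u) x (delta_mx ord0 i).

(* R[i] carries no R-normed structure in the library, so complex-valued
   functions are differentiated and integrated componentwise. *)
Definition csmooth f : Prop :=
  smooth (fun x => complex.Re (f x)) /\ smooth (fun x => complex.Im (f x)).

Definition cpartial s f (x : Rd) : C :=
  partial s (fun y => complex.Re (f y)) x +i*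
  partial s (fun y => complex.Im (f y)) x.

Definition cintegral (mu : {measure set (borelRd R d) -> \bar R}) f : C :=
  (\int[mu]_(x in setT) complex.Re (f x)) +i*
  (\int[mu]_(x in setT) complex.Im (f x)).

(* The usual increasing family of norms defining the Schwartz topology: the
   supremum of (1 + |x|)^N |D^s f(x)| over x and all s of order at most N. *)
Definition schwartz_norm (N : nat) f : \bar R :=
  ereal_sup [set ((1 + euclid p.2) ^+ N * Normc.normc (cpartial p.1 f p.2))%:E
            | p in [set p : seq 'I_d * Rd | (size p.1 <= N)%N]].

Definition schwartz f : Prop :=
  csmooth f /\ forall N, (schwartz_norm N f < +oo)%E.

(* A distribution is a function on all of Rd -> C, of which only the
   restriction to Schwartz functions is meaningful. The second clause is
   continuity for the topology generated by the norms schwartz_norm N. *)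
Definition tempered_distribution (pi : (Rd -> C) -> C) : Prop :=
  (forall (a : C) f g, schwartz f -> schwartz g ->
     pi (fun x => a * f x + g x) = a * pi f + pi g) /\
  (forall f, schwartz f -> forall e : R, 0 < e ->
     exists N : nat, exists2 dl : R, 0 < dl &
       forall g, schwartz g ->
         (schwartz_norm N (fun x => (g x - f x)%R) < dl%:E)%E ->
         Normc.normc (pi g - pi f) < e).

(* In R[i], 0 <= z means that z is real and nonnegative. *)
Definition nonnegative (pi : (Rd -> C) -> C) : Prop :=
  forall psi, schwartz psi -> (forall x, 0 <= psi x) -> 0 <= pi psi.

Definition convolution f g (x : Rd) : C :=
  cintegral (lebesgue_Rd R d) (fun y => f (x - y) * g y).

Definition reflection psi (x : Rd) : C := psi (- x).

Definition nonnegative_definite (pi : (Rd -> C) -> C) : Prop :=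
  forall psi, schwartz psi ->
    0 <= pi (convolution psi (fun x => (reflection psi x)^*)).

Definition correlation (pi : (Rd -> C) -> C) : Prop :=
  [/\ tempered_distribution pi, nonnegative pi & nonnegative_definite pi].

Definition tempered_measure (mu : {measure set (borelRd R d) -> \bar R}) :
    Prop :=
  exists2 k : R, 0 <= k &
    (\int[mu]_(x in setT) ((1 + euclid x ^+ 2) `^ (- k / 2))%:E < +oo)%E.

Definition identified (pi : (Rd -> C) -> C)
    (mu : {measure set (borelRd R d) -> \bar R}) : Prop :=
  tempered_measure mu /\ forall psi, schwartz psi -> pi psi = cintegral mu psi.

Definition integrable_near0 (pi : (Rd -> C) -> C) (k : Rd -> \bar R) : Prop :=
  exists2 mu : {measure set (borelRd R d) -> \bar R}, identified pi mu &
    (\int[mu]_(x in [set x | (euclid x < 1)%R]) k x < +oo)%E.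

Definition alpha (delta0 gamma r : R) : R :=
  d%:R - r * (d%:R - delta0 * (1 - gamma)).

(* In the library 0 `^ a = 0 for a != 0 and ln 0 = 0, hence the explicit
   value +oo at the origin. *)
Definition power_kernel (a : R) (x : Rd) : \bar R :=
  if x == 0 then +oo%E else (euclid x `^ a)%:E.

Definition log_kernel (x : Rd) : \bar R :=
  if x == 0 then +oo%E else (ln (1 / euclid x))%:E.

(* The reinforced (r = 1) or strongly reinforced (r > 1) Dalang condition. *)
Definition dalang_condition (delta0 gamma r : R) (pi : (Rd -> C) -> C) :
    Prop :=
  let a := alpha delta0 gamma r in
  [/\ correlation pi,
      0 < a < d%:R / 2 -> integrable_near0 pi (power_kernel (2 * a - d%:R)) &
      a = d%:R / 2 -> integrable_near0 pi log_kernel].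

End correlations.

(* Main.v *)
Require Import Defs.
From mathcomp Require Import all_boot all_order all_algebra.
From mathcomp Require Import all_classical all_reals all_analysis.
From mathcomp Require Import complex.
From mathcomp Require Import lra.

(** The exponent [alpha r = d - r (d - delta0 (1 - gamma))] is strictly
decreasing in [r], because [delta0 (1 - gamma) < 1 <= d].  Passing from [r2]
to a smaller [r1] therefore raises [alpha], which makes the weight at the
origin less singular: on the unit ball,

- if [a2 < a1] then [|x| ^ (2 a1 - d) <= |x| ^ (2 a2 - d)];
- if [a2 < d / 2] then, with [e := d - 2 a2 > 0],
  [log (1 / |x|) = log (|x| ^ (- e)) / e <= |x| ^ (2 a2 - d) / e].

Whenever the condition for [r1] asks for an integral to be finite, one has
[alpha r1 <= d / 2], hence [0 < alpha r2 < d / 2], and the condition for [r2]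
provides a measure representing [pi] that integrates [|x| ^ (2 alpha r2 - d)].
The same measure integrates the weight required for [r1], by domination
([integrable_near0_dominated]). *)

Set Implicit Arguments.
Unset Strict Implicit.
Unset Printing Implicit Defensive.

Import Order.TTheory GRing.Theory Num.Theory.
Import HBNNSimple.

Local Open Scope ring_scope.

(** The integral of a nonnegative function is a supremum over the simple
functions below it, and dividing by [C] maps simple functions below [f] to
simple functions below [g].  Arguing on this supremum, rather than through
linearity of the integral, covers arbitrary nonnegative functions. *)
Lemma ge0_integral_le_mull d (T : measurableType d) (R : realType)
    (mu : {measure set T -> \bar R}) (D : set T) (f g : T -> \bar R) (C : R) :
  0 < C -> (forall x, D x -> 0 <= f x)%E ->
  (forall x, D x -> f x <= C%:E * g x)%E ->
  (\int[mu]_(x in D) f x <= C%:E * \int[mu]_(x in D) g x)%E.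
Proof.
move=> C0 f0 fg.
have g0 x : D x -> (0 <= g x)%E.
  move=> Dx; rewrite -(@pmule_rge0 _ C%:E) ?lte_fin//.
  exact: le_trans (f0 _ Dx) (fg _ Dx).
rewrite !ge0_integralE//; apply: ge_ereal_sup => _ [h /= hf <-].
have Ci0 : 0 <= C^-1 by rewrite invr_ge0 ltW.
pose h' := scale_nnsfun h Ci0.
have -> : sintegral mu h = (C%:E * sintegral mu h')%E.
  by rewrite -sintegralrM; apply: eq_sintegral => x /=; rewrite mulVKf ?gt_eqF.
rewrite lee_pmul2l ?lte_fin//; apply: ereal_sup_ubound; exists h' => //= x.
rewrite -(@lee_pmul2l _ C%:E) ?lte_fin//.
rewrite -EFinM mulVKf ?gt_eqF//.
apply: le_trans (hf x) _; rewrite /patch.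
by case: ifPn; rewrite ?inE ?mule0// => /fg.
Qed.

Lemma euclid_gt0 (R : realType) d (x : 'rV[R]_d) : x != 0 -> 0 < euclid x.
Proof.
move=> xN0; rewrite sqrtr_gt0 lt_neqAle sumr_ge0 ?andbT; last first.
  by move=> i _; exact: sqr_ge0.
apply: contra xN0; rewrite eq_sym psumr_eq0; last by move=> i _; exact: sqr_ge0.
move=> /allP x0; apply/eqP/rowP => i; rewrite mxE.
by apply/eqP; rewrite -sqrf_eq0; apply: x0; rewrite mem_index_enum.
Qed.

Lemma integrable_near0_dominated (R : realType) d
    (pi : ('rV[R]_d -> R[i]) -> R[i]) (k1 k2 : 'rV[R]_d -> \bar R) (C : R) :
  0 < C -> (forall x, euclid x < 1 -> (0 <= k1 x)%E) ->
  (forall x, euclid x < 1 -> (k1 x <= C%:E * k2 x)%E) ->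
  integrable_near0 pi k2 -> integrable_near0 pi k1.
Proof.
move=> C0 k10 k12 [mu pimu k2mu]; exists mu => //.
apply: le_lt_trans (ge0_integral_le_mull mu C0 k10 k12) _.
by rewrite lte_mul_pinfty// lee_fin ltW.
Qed.

Lemma power_kernel_ge0 (R : realType) d (a : R) (x : 'rV[R]_d) :
  (0 <= power_kernel a x)%E.
Proof. by rewrite /power_kernel; case: ifP; rewrite ?leey// lee_fin powR_ge0. Qed.

Lemma log_kernel_ge0 (R : realType) d (x : 'rV[R]_d) :
  euclid x < 1 -> (0 <= log_kernel x)%E.
Proof.
rewrite /log_kernel; case: ifPn => [|/euclid_gt0 x0] x1; rewrite ?leey//.
by rewrite lee_fin ln_ge0// div1r invf_ge1// ltW.
Qed.

Lemma le_power_kernel (R : realType) d (a b : R) (x : 'rV[R]_d) :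
  b <= a -> euclid x < 1 -> (power_kernel a x <= power_kernel b x)%E.
Proof.
move=> ba x1; rewrite /power_kernel; case: ifPn => // /euclid_gt0 x0.
by rewrite lee_fin ger_powR// x0 ltW.
Qed.

(** A logarithmic singularity is weaker than any negative power, with constant
[1 / e], since [e * ln (1 / t) = ln (t `^ (- e)) <= t `^ (- e)]. *)
Lemma le_log_power_kernel (R : realType) d (e : R) (x : 'rV[R]_d) :
  0 < e -> (log_kernel x <= e^-1%:E * power_kernel (- e) x)%E.
Proof.
move=> e0; rewrite /log_kernel /power_kernel.
case: ifPn => [_|/euclid_gt0 x0]; first by rewrite gt0_muley ?lte_fin ?invr_gt0.
rewrite -EFinM lee_fin ler_pdivlMl// div1r lnV ?posrE// mulrN -mulNr -ln_powR.
by rewrite ltW// ln_sublinear// powR_gt0.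
Qed.

(** The slope of [alpha] in [r] is negative because
[delta0 * (1 - gamma) < 1 <= d]. *)
Lemma alpha_lt (R : realType) (d : nat) (delta0 gamma r1 r2 : R) :
  (1 <= d)%N -> 0 < delta0 <= 1 -> 0 < gamma < 1 -> r1 < r2 ->
  alpha d delta0 gamma r2 < alpha d delta0 gamma r1.
Proof.
move=> d1 delta gam r12; rewrite /alpha ltrD2l ltrN2 ltr_pM2r//.
have : 1 <= d%:R :> R by rewrite ler1n.
nra.
Qed.

Lemma alpha_gt0 (R : realType) (d : nat) (delta0 gamma r : R) :
  (1 <= d)%N -> 0 < delta0 <= 1 -> 0 < gamma < 1 ->
  r < d%:R / (d%:R - delta0 * (1 - gamma)) -> 0 < alpha d delta0 gamma r.
Proof.
move=> d1 delta gam; rewrite /alpha ltr_pdivlMr ?subr_gt0//.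
have : 1 <= d%:R :> R by rewrite ler1n.
nra.
Qed.

Theorem proposition1p6 (R : realType) (d : nat) (delta0 gamma r1 r2 : R)
    (pi : ('rV[R]_d -> R[i]) -> R[i]) :
  (1 <= d)%N ->
  0 < delta0 <= 1 ->
  0 < gamma < 1 ->
  1 <= r1 < d%:R / (d%:R - delta0 * (1 - gamma)) ->
  1 <= r2 < d%:R / (d%:R - delta0 * (1 - gamma)) ->
  correlation pi ->
  dalang_condition delta0 gamma r2 pi ->
  r1 < r2 ->
  dalang_condition delta0 gamma r1 pi.
Proof.
move=> d1 delta gam _ /andP[_ r2d] cpi [_ pow2 _] r12.
have a20 := alpha_gt0 d1 delta gam r2d.
have a21 := alpha_lt d1 delta gam r12.
rewrite /dalang_condition; move: (alpha _ _ _ r1) a21 => a1.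
move: (alpha _ _ _ r2) a20 pow2 => a2 a20 pow2 a21.
split=> // [/andP[_ a1d]|a1d].
- apply: (integrable_near0_dominated ltr01 _ _ (pow2 _)) => [x _|x x1|].
  + exact: power_kernel_ge0.
  + by rewrite mul1e le_power_kernel//; lra.
  + by rewrite a20 (lt_trans a21 a1d).
- have e0 : 0 < d%:R - 2 * a2 by lra.
  have Ce0 : 0 < (d%:R - 2 * a2)^-1 by rewrite invr_gt0.
  apply: (integrable_near0_dominated Ce0 _ _ (pow2 _)) => [x|x _|].
  + exact: log_kernel_ge0.
  + by rewrite -(opprB d%:R) le_log_power_kernel.
  + by rewrite a20 -a1d.
Qed.
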